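(* Let $t, s$ be non-negative integers. Let $k \ge s+1$, $n \ge 2k+t$ and $m > k+t+s$ be integers. Let $$\mathcal{F} \subseteq \left\{A\in \binom{[n]}{k+t}: |A\cap[m]|\ge t+s+1\right\} \quad\text{and}\quad \mathcal{G} \subseteq \left\{B\in \binom{[n]}{k}: |B\cap[m]|\ge s+1\right\}$$ be cross-intersecting families. Suppose that $\mathcal{F}$ is $t$-intersecting. Then $$|\mathcal{F}|+|\mathcal{G}| \le \binom{n}{k}-\sum_{i=0}^{s}\binom{m}{i}\binom{n-m}{k-i}.$$
   Context: $[n]=\{1,2,\ldots,n\}$, and for a set $X$, $\binom{X}{k}$ denotes the family of all $k$-element subsets of $X$. Two families $\mathcal{F},\mathcal{G}\subseteq 2^{[n]}$ are cross-intersecting if $|F\cap G|\ge 1$ for all $F\in\mathcal{F}$ and $G\in\mathcal{G}$. A family $\mathcal{F}\subseteq 2^{[n]}$ is $t$-intersecting if $|F\cap F'|\ge t$ for all $F,F'\in\mathcal{F}$. The integer $m$ is allowed to be larger than $n$. Convention: for integers $a$ and $b\ge 0$, $\binom{a}{b}=0$ whenever $a<b$, including when $a$ is negative; thus for $m\ge n$ the right-hand side equals $\binom{n}{k}$. *)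

(* Defs.v *)
From mathcomp Require Import all_boot all_order all_algebra.

Set Implicit Arguments.
Unset Strict Implicit.
Unset Printing Implicit Defensive.

(* The ground set {1, ..., n} is represented by 'I_n = {0, ..., n - 1}, the
   element j of the former being the ordinal of value j - 1.  Thus
   [initial n m] is {1, ..., m} :&: {1, ..., n}, which is the whole ground set
   when m >= n. *)
Definition initial (n m : nat) : {set 'I_n} := [set x : 'I_n | x < m].

Definition cross_intersecting (T : finType) (F G : {set {set T}}) : Prop :=
  forall A B : {set T}, A \in F -> B \in G -> 1 <= #|A :&: B|.

(* A and A' are not required to be distinct. *)
Definition t_intersecting (T : finType) (t : nat) (F : {set {set T}}) : Prop :=
  forall A A' : {set T}, A \in F -> A' \in F -> t <= #|A :&: A'|.

(* Binomial coefficient with an integer upper index; it vanishes when that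
   index is negative (this is not the polynomial extension). *)
Definition binz (a : int) (b : nat) : nat :=
  if a is Posz a' then 'C(a', b) else 0.

(* Main.v *)
(* Shifting the pair (F, G) towards small elements keeps the sizes, both
   intersection conditions and both lower bounds on the traces on [m], so F and
   G may be assumed shifted.  Read a set as a lattice walk, one step per point
   of [n].  A member A of a shifted t-intersecting family meets the line
   2 |A :&: [q]| = q + t; let p be the last such q and reflect the walk before
   p, i.e. replace A by its complement inside [p].  The result A' has k elements
   and at least s + 1 of them in [m], and A can be recovered from A'.  Moreover
   |A :&: [q]| + |A' :&: [q]| <= q for all q, which prevents A' from belonging
   to the shifted family G.  Hence G and the reflection of F are disjoint
   subfamilies of the k-sets with at least s + 1 points in [m]. *)
Require Import Defs.
From mathcomp Require Import all_boot all_order all_algebra.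
From mathcomp Require Import perm zify.

Set Implicit Arguments.
Unset Strict Implicit.
Unset Printing Implicit Defensive.

(** * Shifting a family by a transposition *)

(** Covers both hypotheses: [t_intersecting t F] is the case [G = F], and [cross_intersecting] is
    the case [c = 1]. *)
Definition cross_tintersecting (T : finType) (c : nat) (F G : {set {set T}}) :=
  forall A B : {set T}, A \in F -> B \in G -> c <= #|A :&: B|.

Section Swap.
Variables (T : finType) (i j : T).

Definition swap (A : {set T}) : {set T} := [set x | tperm i j x \in A].

Lemma swapK : involutive swap.
Proof. by move=> A; apply/setP=> x; rewrite !inE tpermK. Qed.

Lemma swapE (A : {set T}) : swap A = tperm i j @: A.
Proof.
apply/setP=> x; rewrite inE; apply/idP/imsetP => [xA | [y yA ->]].
  by exists (tperm i j x); rewrite ?tpermK.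
by rewrite tpermK.
Qed.

Lemma card_swap (A : {set T}) : #|swap A| = #|A|.
Proof. by rewrite swapE card_imset //; apply: perm_inj. Qed.

Lemma swapI (A B : {set T}) : swap (A :&: B) = swap A :&: swap B.
Proof. by apply/setP=> x; rewrite !inE. Qed.

Lemma card_swapI (A B : {set T}) : #|swap A :&: B| = #|A :&: swap B|.
Proof. by rewrite -[RHS]card_swap swapI swapK. Qed.

(** If [j] is in [B], then so is [i] and the swap fixes [B]; otherwise [A :&: B] contains neither
    [i] nor [j], so the swap does not touch it. *)
Lemma leq_card_swapI (A B : {set T}) :
  i \notin A -> (j \in B -> i \in B) -> #|A :&: B| <= #|swap A :&: B|.
Proof.
move=> iA jB.
case: (boolP (j \in B)) => [jB' | jNB].
  rewrite card_swapI (_ : swap B = B) //; have iB := jB jB'.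
  by apply/setP=> x; rewrite inE; case: tpermP => [->|->|_ _]; rewrite ?iB ?jB'.
apply/subset_leq_card/subsetP=> x; rewrite !inE => /andP[xA xB]; rewrite xB.
by rewrite tpermD ?xA //; [apply: contraNneq iA | apply: contraNneq jNB] => ->.
Qed.

Definition movable (A : {set T}) : bool := (j \in A) && (i \notin A).

Definition shift_in (F : {set {set T}}) (A : {set T}) : {set T} :=
  if movable A && (swap A \notin F) then swap A else A.

Definition shift (F : {set {set T}}) : {set {set T}} := shift_in F @: F.

(** A moved set lands outside [F], so it cannot collide with one that stayed. *)
Lemma card_shift (F : {set {set T}}) : #|shift F| = #|F|.
Proof.
apply: card_in_imset => A B AF BF; rewrite /shift_in.
case: ifP => [/andP[_ sA]|_]; case: ifP => [/andP[_ sB]|_] //.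
- by move/(can_inj swapK).
- by move=> e; rewrite e BF in sA.
- by move=> e; rewrite -e AF in sB.
Qed.

Lemma shift_sub (P : pred {set T}) (F : {set {set T}}) :
  (forall A, movable A -> P A -> P (swap A)) ->
  {in F, forall A, P A} -> {in shift F, forall A, P A}.
Proof.
move=> Pswap FP _ /imsetP[A AF ->]; rewrite /shift_in.
by case: ifP => [/andP[mA _]|_]; [apply: Pswap => //|]; apply: FP.
Qed.

Lemma cross_shift (c : nat) (F G : {set {set T}}) :
  cross_tintersecting c F G -> cross_tintersecting c (shift F) (shift G).
Proof.
move=> FG.
(* The delicate case: [A] moves and [B] stays. Either [B] is not movable and the intersection does
   not shrink, or [swap B] is in [Y] and the swap can be transferred from [A] to it. *)
have mixed (X Y : {set {set T}}) (A B : {set T}) : cross_tintersecting c X Y ->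
    A \in X -> B \in Y -> movable A -> ~~ (movable B && (swap B \notin Y)) ->
    c <= #|swap A :&: B|.
  move=> XY AX BY /andP[jA iA]; rewrite negb_and negbK => /orP[mB|sB].
    apply: leq_trans (XY _ _ AX BY) (leq_card_swapI iA _).
    by move=> jB; move: mB; rewrite /movable jB negbK.
  by rewrite card_swapI; apply: XY.
move=> _ _ /imsetP[A AF ->] /imsetP[B BG ->]; rewrite /shift_in.
case: ifP => [/andP[mA _]|/negbT nA]; case: ifP => [/andP[mB _]|/negbT nB].
- by rewrite -swapI card_swap; apply: FG.
- exact: (mixed F G).
- rewrite setIC; apply: (mixed G F) => // ? ? ? ?.
  by rewrite setIC; apply: FG.
- exact: FG.
Qed.

End Swap.

(** * Reduction to shifted families *)

Section Shifted.
Variable n : nat.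
Implicit Types (A B : {set 'I_n}) (F G : {set {set 'I_n}}).

Definition shifted F :=
  forall (i j : 'I_n) A, i < j -> movable i j A -> A \in F -> swap i j A \in F.

(** Termination measure: a shift with [i < j] that changes the family lowers it. *)
Definition weight F : nat := \sum_(A in F) \sum_(x in A) x.

Lemma weight_swap (i j : 'I_n) A : i < j -> movable i j A ->
  \sum_(x in swap i j A) x < \sum_(x in A) x.
Proof.
move=> ij /andP[jA iA].
rewrite swapE big_imset /=; last by move=> ? ? _ _; apply: perm_inj.
rewrite (big_setD1 j) //= [X in _ < X](big_setD1 j) //= tpermR.
rewrite (eq_bigr (fun x : 'I_n => x : nat)) ?ltn_add2r // => x.
rewrite !inE => /andP[xj xA]; rewrite tpermD // eq_sym //.
by apply: contraNneq iA => <-.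
Qed.

Lemma leq_sum_shift_in (i j : 'I_n) F A : i < j ->
  \sum_(x in shift_in i j F A) x <= \sum_(x in A) x.
Proof.
by move=> ij; rewrite /shift_in; case: ifP => // /andP[/(weight_swap ij)/ltnW].
Qed.

Lemma weightE_shift (i j : 'I_n) F :
  weight (shift i j F) = \sum_(A in F) \sum_(x in shift_in i j F A) x.
Proof.
by rewrite /weight big_imset //=; apply/imset_injP; rewrite card_shift.
Qed.

Lemma weight_shift (i j : 'I_n) F : i < j ->
  weight (shift i j F) <= weight F.
Proof.
move=> ij; rewrite weightE_shift.
by apply: leq_sum => A _; apply: leq_sum_shift_in.
Qed.

Lemma weight_shift_lt (i j : 'I_n) F A : i < j -> movable i j A -> A \in F ->
  swap i j A \notin F -> weight (shift i j F) < weight F.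
Proof.
move=> ij mA AF sA; rewrite weightE_shift /weight.
rewrite (big_setD1 A) //= [X in _ < X](big_setD1 A) //= -addSn leq_add //.
  by rewrite /shift_in mA sA weight_swap.
by apply: leq_sum => B _; apply: leq_sum_shift_in.
Qed.

Definition shiftedb F : bool :=
  [forall i : 'I_n, forall j : 'I_n, forall A : {set 'I_n},
     (i < j) ==> movable i j A ==> (A \in F) ==> (swap i j A \in F)].

Lemma shiftedP F : reflect (shifted F) (shiftedb F).
Proof.
apply: (iffP forallP) => [H i j A ij mA AF | H i].
  by move/forallP/(_ j)/forallP/(_ A): (H i); rewrite ij mA AF.
apply/forallP=> j; apply/forallP=> A.
by apply/implyP=> ij; apply/implyP=> mA; apply/implyP=> AF; apply: H.
Qed.

Lemma weight_shift_exists F : ~~ shiftedb F ->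
  exists i j : 'I_n, i < j /\ weight (shift i j F) < weight F.
Proof.
case/forallPn=> i /forallPn[j /forallPn[A]].
rewrite !negb_imply => /and4P[ij mA AF sA].
by exists i, j; split=> //; apply: weight_shift_lt sA.
Qed.

(** Induction on the total weight. Both families undergo the same shift, as [cross_shift] requires;
    one drops in weight while the other does not gain. *)
Lemma exists_shifted (t c : nat) (P Q : pred {set 'I_n}) F G :
  (forall (i j : 'I_n) A, i < j -> movable i j A -> P A -> P (swap i j A)) ->
  (forall (i j : 'I_n) A, i < j -> movable i j A -> Q A -> Q (swap i j A)) ->
  {in F, forall A, P A} -> {in G, forall B, Q B} ->
  cross_tintersecting t F F -> cross_tintersecting c F G ->
  exists F' G' : {set {set 'I_n}},
    [/\ #|F'| = #|F| /\ #|G'| = #|G|,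
        {in F', forall A, P A} /\ {in G', forall B, Q B},
        cross_tintersecting t F' F', cross_tintersecting c F' G' &
        shifted F' /\ shifted G'].
Proof.
move=> Pswap Qswap; move: {2}_.+1 (ltnSn (weight F + weight G)) => w.
elim: w F G => // w IH F G ltw FP GQ FF FG.
have step (i j : 'I_n) : i < j ->
    weight (shift i j F) + weight (shift i j G) < weight F + weight G ->
    exists F' G' : {set {set 'I_n}},
    [/\ #|F'| = #|F| /\ #|G'| = #|G|,
        {in F', forall A, P A} /\ {in G', forall B, Q B},
        cross_tintersecting t F' F', cross_tintersecting c F' G' &
        shifted F' /\ shifted G'].
  move=> ij lt.
  have [|||||F' [G' []]] := IH (shift i j F) (shift i j G).
  - by lia.
  - by apply: shift_sub FP => A; apply: Pswap.
  - by apply: shift_sub GQ => A; apply: Qswap.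
  - exact: cross_shift.
  - exact: cross_shift.
  - by rewrite !card_shift => *; exists F', G'.
case: (boolP (shiftedb F)) => [/shiftedP sF | /weight_shift_exists].
  case: (boolP (shiftedb G)) => [/shiftedP sG | /weight_shift_exists].
    by exists F, G.
  case=> i [j [ij lt]]; apply: (step i j ij).
  by have := weight_shift F ij; lia.
case=> i [j [ij lt]]; apply: (step i j ij).
by have := weight_shift G ij; lia.
Qed.

(** * Traces of sets on initial segments *)

Lemma card_initial (q : nat) : #|initial n q| = minn q n.
Proof.
rewrite -sum1_card big_mkcond /=.
rewrite (eq_bigr (fun x : 'I_n => (x < q) : nat)) => [|x _]; last first.
  by rewrite inE; case: (x < q).
elim: n => [|r IH]; first by rewrite big_ord0; lia.
by rewrite big_ord_recr /= IH; case: ltnP; lia.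
Qed.

Lemma leq_card_initial A (q : nat) : #|A :&: initial n q| <= q.
Proof.
apply: leq_trans (subset_leq_card (subsetIr _ _)) _.
by rewrite card_initial geq_minl.
Qed.

Lemma initial_all A (q : nat) : n <= q -> A :&: initial n q = A.
Proof. by move=> nq; apply/setP=> x; rewrite !inE (leq_trans (ltn_ord x)) ?andbT. Qed.

Lemma leq_initial A (q r : nat) : q <= r ->
  #|A :&: initial n q| <= #|A :&: initial n r|.
Proof.
move=> qr; apply/subset_leq_card/setIS/subsetP=> x; rewrite !inE => xq.
exact: leq_trans qr.
Qed.

Lemma card_initialS A (x : 'I_n) :
  #|A :&: initial n x.+1| = (x \in A) + #|A :&: initial n x|.
Proof.
rewrite (cardsD1 x) !inE ltnSn andbT; congr (_ + #|pred_of_set _|).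
apply/setP=> y; rewrite !inE ltnS ltn_neqAle -val_eqE /=.
by case: (_ == _) => /=; rewrite ?andbF // andbC.
Qed.

(* Otherwise the c-th common element x of A and B has a point y < x missing
   from both on its left, and moving x to y in B preserves the negation of the
   conclusion while it decreases |A :&: B|. *)
Lemma cross_shifted_prefix (c : nat) F G A B :
  cross_tintersecting c F G -> shifted G -> A \in F -> B \in G ->
  exists2 q, q <= n &
    q + c <= #|A :&: initial n q| + #|B :&: initial n q|.
Proof.
move=> FG sG AF.
have cardUI X Y q : #|X :&: initial n q| + #|Y :&: initial n q| =
    #|(X :|: Y) :&: initial n q| + #|(X :&: Y) :&: initial n q|.
  rewrite -cardsUI -setIUl; congr (_ + #|pred_of_set _|).
  by rewrite setIACA setIid.
move: {2}_.+1 (ltnSn #|A :&: B|) => w; elim: w B => // w IH B ltw BG.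
case: (posnP c) => [->|c0]; first by exists 0; lia.
have leAB := FG _ _ AF BG.
have ex : exists q, c <= #|(A :&: B) :&: initial n q|.
  by exists n; rewrite initial_all.
case: (ex_minnP ex) => x0 cx0 minx0.
have x0_gt0 : 0 < x0 by rewrite lt0n; apply: contraTneq cx0 => ->;
  have := leq_card_initial (A :&: B) 0; lia.
have x0n : x0 <= n by apply: minx0; rewrite initial_all.
have xn : x0.-1 < n by lia.
pose x := Ordinal xn.
have x0E : x0 = x.+1 by rewrite /= prednK.
rewrite x0E in cx0 minx0.
have ltc q : q <= x -> #|(A :&: B) :&: initial n q| < c.
  by move=> qx; rewrite ltnNge; apply/negP => /minx0; lia.
have xAB : x \in A :&: B.
  move: cx0 (ltc x (leqnn _)); rewrite card_initialS; case: (x \in _) => //=; lia.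
have cx : #|(A :&: B) :&: initial n x.+1| = c.
  by move: cx0 (ltc x (leqnn _)); rewrite card_initialS xAB; lia.
case: (leqP (x.+1 + c) (#|A :&: initial n x.+1| + #|B :&: initial n x.+1|)) => [|lt].
  by exists x.+1 => //; rewrite -x0E.
(* If [A :|: B] covered the first [x.+1] points, the two traces would sum to [x.+1 + c], against
   [lt]. *)
have /subsetPn[y yx] : ~~ (initial n x.+1 \subset A :|: B).
  apply/negP=> /setIidPr e; move: lt.
  by rewrite cardUI cx e card_initial; lia.
move: xAB; rewrite !inE negb_or in yx * => /andP[xA xB] /andP[yA yB].
have yltx : y < x.
  have : y != x by apply: contraNneq yA => ->.
  by rewrite -val_eqE /= in yx *; lia.
have mB : movable y x B by rewrite /movable xB yB.
pose B' := swap y x B.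
have B'G : B' \in G by apply: sG.
have B'E : B' = y |: (B :\ x).
  apply/setP=> z; rewrite !inE; case: tpermP => [->|->|].
  - by rewrite eqxx xB.
  - by rewrite eqxx /= (negbTE yB) orbF; apply/esym/eqP => e; rewrite -e xB in yB.
  - by move=> /eqP /negbTE -> /eqP ->.
have AB' : A :&: B' = (A :&: B) :\ x.
  apply/setP=> z; rewrite B'E !inE; case: (eqVneq z y) => [->|_] /=.
    by rewrite (negbTE yA) andbF.
  by rewrite andbCA.
have ltAB' : #|A :&: B'| < w.
  by move: ltw; rewrite AB' (cardsD1 x (A :&: B)) inE xA xB.
have [q qn] := IH B' ltAB' B'G.
(* A prefix ending before [x] has fewer than [c] common points, so its traces sum to less than
   [q + c]; a longer one contains both [x] and [y], so [B] and [B'] have equally many points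
   there. *)
case: (ltnP q x.+1) => [qx | xq].
  rewrite cardUI => ?; have := leq_card_initial (A :|: B') q.
  have := ltc q qx.
  have : #|(A :&: B') :&: initial n q| <= #|(A :&: B) :&: initial n q|.
    by rewrite AB'; apply/subset_leq_card/setSI/subsetDl.
  lia.
exists q => //; rewrite (_ : #|B :&: _| = #|B' :&: initial n q|) //.
rewrite -[LHS](card_swap y x) swapI; congr #|pred_of_set (_ :&: _)|.
by apply/setP=> z; rewrite !inE; case: tpermP => [->|->|] //; lia.
Qed.

Lemma card_setC_initial A (q : nat) : q <= n ->
  #|A :&: initial n q| + #|~: A :&: initial n q| = q.
Proof.
move=> qn; rewrite [A :&: _]setIC [~: A :&: _]setIC -setDE cardsID.
by rewrite card_initial; lia.
Qed.

(** * Reflection of the walk before its last hit *)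

Section Reflection.
Variable t : nat.

(** Members minus non-members among the first [q] points number at least [t]. The inequality becomes
    an equality at the last hit, by [last_hitE]. *)
Definition hit A (q : nat) : bool := q + t <= 2 * #|A :&: initial n q|.

Definition last_hit A : nat := \max_(q < n.+1 | hit A q) q.

Definition reflection A : {set 'I_n} :=
  [set x : 'I_n | if x < last_hit A then x \notin A else x \in A].

Lemma last_hit_leq A : last_hit A <= n.
Proof. by apply/bigmax_leqP=> q _; rewrite -ltnS. Qed.

Lemma last_hit_max A (q : nat) : q <= n -> hit A q -> q <= last_hit A.
Proof.
move=> qn hq; have q1 : q < n.+1 by [].
exact: (leq_bigmax_cond (Ordinal q1) hq).
Qed.

(** Past the last hit [p < n] the inequality fails at [p.+1], while the trace does not decrease,
    which forces equality at [p]. For [p = n] the bound on [#|A|] does this. *)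
Lemma last_hitE A : 2 * #|A| <= n + t -> (exists2 q, q <= n & hit A q) ->
  2 * #|A :&: initial n (last_hit A)| = last_hit A + t.
Proof.
move=> szA [q qn hq]; have hitp : hit A (last_hit A).
  have q1 : q < n.+1 by [].
  have c0 : 0 < #|[pred q : 'I_n.+1 | hit A q]|.
    by apply/card_gt0P; exists (Ordinal q1).
  by rewrite /last_hit; case: (eq_bigmax_cond val c0) => r hr ->.
move: (hitp); rewrite /hit; set p := last_hit A in hitp * => le.
have pn : p <= n := last_hit_leq A.
case: (eqVneq p n) => [pnE | pNn].
  by move: le; rewrite pnE initial_all //; lia.
have ltpn : p < n by lia.
have : ~~ hit A p.+1.
  by apply/negP=> /(last_hit_max ltpn); rewrite -/p ltnn.
by rewrite /hit; have := leq_initial A (leqnSn p); lia.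
Qed.

Lemma card_reflection_lo A (q : nat) : q <= last_hit A ->
  #|A :&: initial n q| + #|reflection A :&: initial n q| = q.
Proof.
move=> qp; have qn := leq_trans qp (last_hit_leq A).
rewrite -[RHS](card_setC_initial A qn); congr (_ + #|pred_of_set _|).
apply/setP=> x; rewrite !inE; case: (ltnP x q) => // xq; rewrite ?andbF //.
by rewrite (leq_trans xq qp).
Qed.

(** Before [p] there are [t] more members than non-members, so complementing loses [t] points;
    beyond [p] nothing changes. *)
Lemma card_reflection_hi A (q : nat) :
  2 * #|A :&: initial n (last_hit A)| = last_hit A + t -> last_hit A <= q ->
  #|reflection A :&: initial n q| + t = #|A :&: initial n q|.
Proof.
set p := last_hit A => hp pq.
have split X : #|X :&: initial n q| =
    #|X :&: initial n p| + #|(X :&: initial n q) :\: initial n p|.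
  rewrite -[LHS](cardsID (initial n p)); congr (#|pred_of_set _| + _).
  rewrite -setIA; congr (_ :&: _); apply/setIidPr/subsetP=> x; rewrite !inE => xp.
  exact: leq_trans pq.
rewrite (split A) (split (reflection A)).
have -> : (reflection A :&: initial n q) :\: initial n p =
    (A :&: initial n q) :\: initial n p.
  by apply/setP=> x; rewrite !inE -/p; case: (x < p).
have := card_reflection_lo (leqnn (last_hit A)); rewrite -/p; lia.
Qed.

(** The image determines the last hit: were that of [B] later, [A] and [B] would have equal traces
    there, making it a hit of [A]. With the same last hit, the complementation can be undone. *)
Lemma reflection_inj F :
  {in F, forall A, 2 * #|A :&: initial n (last_hit A)| = last_hit A + t} ->
  {in F &, injective reflection}.
Proof.
move=> hitF.
have le A B : A \in F -> B \in F -> reflection A = reflection B ->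
    last_hit B <= last_hit A.
  move=> AF BF e; case: (leqP (last_hit B) (last_hit A)) => // lt.
  have hA := card_reflection_hi (hitF _ AF) (ltnW lt).
  have hB := card_reflection_hi (hitF _ BF) (leqnn _).
  suff : last_hit B <= last_hit A by rewrite leqNgt lt.
  apply: last_hit_max; first exact: last_hit_leq.
  by rewrite /hit -hA e hB hitF.
move=> A B AF BF e.
have pE : last_hit A = last_hit B.
  by apply/eqP; rewrite eqn_leq !le // -e.
apply/setP=> x; move/setP/(_ x): e; rewrite !inE pE.
by case: ifP => // _; apply: negb_inj.
Qed.

End Reflection.

Lemma leq_card_shifted (t s k m : nat) F G :
  2 * k + t <= n -> k + t + s < m ->
  {in F, forall A, (#|A| == k + t) && (t + s + 1 <= #|A :&: initial n m|)} ->
  {in G, forall B, (#|B| == k) && (s + 1 <= #|B :&: initial n m|)} ->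
  cross_tintersecting t F F -> cross_tintersecting 1 F G ->
  shifted F -> shifted G ->
  #|F| + #|G| <=
    #|[set B : {set 'I_n} | (#|B| == k) && (s + 1 <= #|B :&: initial n m|)]|.
Proof.
move=> hn hm FP GQ FF FG sF sG.
have hitF : {in F, forall A,
    2 * #|A :&: initial n (last_hit t A)| = last_hit t A + t}.
  move=> A AF; have /andP[/eqP szA _] := FP _ AF.
  apply: last_hitE; first by lia.
  (* Taking the same set twice turns the prefix bound into a hit. *)
  have [q qn le] := cross_shifted_prefix FF sF AF AF.
  by exists q => //; rewrite /hit; lia.
rewrite -(card_in_imset (reflection_inj hitF)) -cardsUI.
rewrite (_ : _ :&: G = set0) ?cards0 ?addn0; last first.
  apply/setP=> B; rewrite !inE; apply/negP=> /andP[/imsetP[A AF ->]] BG.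
  have [q qn] := cross_shifted_prefix FG sG AF BG.
  (* Up to the last hit the traces sum to exactly [q]; beyond it to [2 * #|A :&: initial n q| - t],
     which is below [q]. Both contradict [q + 1]. *)
  case: (leqP q (last_hit t A)) => [qp | pq].
    by rewrite card_reflection_lo //; lia.
  have := card_reflection_hi (hitF _ AF) (ltnW pq).
  have : ~~ hit t A q by apply/negP=> /(last_hit_max qn); lia.
  by rewrite /hit; lia.
apply/subset_leq_card/subsetP=> B; rewrite !inE => /orP[|/GQ //].
move=> /imsetP[A AF ->]; have /andP[/eqP szA leA] := FP _ AF.
have hi := card_reflection_hi (hitF _ AF).
apply/andP; split.
  by have := hi n (last_hit_leq _ _); rewrite !initial_all //; lia.
(* If the last hit is at most [m], the trace loses only [t] points. Otherwise it equals [m] minus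
   that of [A], hence is at least [m - (k + t)], and [hm] gives [s + 1]. *)
case: (leqP (last_hit t A) m) => [/hi | /ltnW /card_reflection_lo]; first lia.
by have := subset_leq_card (subsetIl A (initial n m)); lia.
Qed.

End Shifted.

(** * Counting k-sets by their trace *)

(** A union of a subset of [M] and a subset of its complement determines both parts. *)
Lemma leq_card_meet_in (T : finType) (M : {set T}) (i k : nat) : i <= k ->
  'C(#|M|, i) * 'C(#|~: M|, k - i) <=
  #|[set B : {set T} | (#|B| == k) && (#|B :&: M| == i)]|.
Proof.
move=> ik; rewrite -!cards_draws -cardsX.
pose D := setX [set X : {set T} | X \subset M & #|X| == i]
               [set Y : {set T} | Y \subset ~: M & #|Y| == k - i].
have partE (u : {set T} * {set T}) : u \in D ->
    ((u.1 :|: u.2) :&: M = u.1) /\ ((u.1 :|: u.2) :&: ~: M = u.2).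
  case: u => X Y; rewrite !inE /= => /andP[/andP[XM _] /andP[YM _]].
  rewrite !setIUl (setIidPl XM) (setIidPl YM).
  move: YM; rewrite -disjoints_subset -setI_eq0 => /eqP ->.
  by move: XM; rewrite -{1}(setCK M) -disjoints_subset -setI_eq0 => /eqP ->;
    rewrite setU0 set0U.
rewrite -/D -(@card_in_imset _ _ (fun u => u.1 :|: u.2) D); last first.
  move=> [X Y] [X' Y'] /partE [/= eX eY] /partE [/= eX' eY'] e.
  by congr (_, _); [rewrite -eX e eX' | rewrite -eY e eY'].
apply/subset_leq_card/subsetP=> _ /imsetP[[X Y] uD ->] /=.
have /= [eX eY] := partE _ uD.
rewrite inE -(cardsID M (X :|: Y)) eX setDE eY.
by move: uD; rewrite !inE /= => /andP[/andP[_ /eqP->] /andP[_ /eqP->]];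
  rewrite subnKC ?eqxx.
Qed.

Lemma card_meet_geq (n m s k : nat) : s < k -> m <= n ->
  #|[set B : {set 'I_n} | (#|B| == k) && (s + 1 <= #|B :&: initial n m|)]| +
    \sum_(0 <= i < s.+1) 'C(m, i) * 'C(n - m, k - i) <= 'C(n, k).
Proof.
move=> sk mn; set M := initial n m.
have cM : #|M| = m by rewrite card_initial; lia.
have cCM : #|~: M| = n - m by rewrite cardsCs setCK card_ord cM.
pose K (r : nat) := [set B : {set 'I_n} | (#|B| == k) && (r <= #|B :&: M|)].
have K0 : #|K 0| = 'C(n, k).
  rewrite -[in RHS](card_ord n) -card_draws; apply: eq_card => B.
  by rewrite !inE andbT.
rewrite addn1 -/(K s.+1) -K0.
(* Peels off the sets with trace exactly [r]: they and [K r.+1] are disjoint inside [K r]. *)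
elim: s.+1 sk => [|r IH] rk; first by rewrite big_geq ?addn0.
apply: leq_trans (IH (ltnW rk)); rewrite big_nat_recr //= addnCA addnC leq_add2r.
have := leq_card_meet_in M (ltnW rk); rewrite cM cCM => leC.
apply: leq_trans (leq_add (leqnn _) leC) _.
rewrite -cardsUI [X in _ + X](_ : _ = 0) ?addn0.
  apply/subset_leq_card/subsetP=> B; rewrite !inE.
  by case: (_ == k) => //= /orP[|]; lia.
by apply/eqP; rewrite cards_eq0; apply/eqP/setP=> B; rewrite !inE; lia.
Qed.

(** * The bound for arbitrary families *)

Theorem theorem3p3 (t s k n m : nat) (F G : {set {set 'I_n}})
  (hk : s + 1 <= k) (hn : 2 * k + t <= n) (hm : k + t + s < m)
  (hF : F \subset [set A : {set 'I_n} |
                     (#|A| == k + t) && (t + s + 1 <= #|A :&: initial n m|)])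
  (hG : G \subset [set B : {set 'I_n} |
                     (#|B| == k) && (s + 1 <= #|B :&: initial n m|)])
  (hFG : cross_intersecting F G)
  (hFt : t_intersecting t F) :
  ((#|F| + #|G|)%:Z <=
   'C(n, k)%:Z - (\sum_(0 <= i < s.+1) 'C(m, i) * binz (n%:Z - m%:Z) (k - i))%N%:Z)%R.
Proof.
(* Moving [j] down to [i] cannot leave [initial n m], so the trace bound survives. *)
have class a b (i j : 'I_n) (A : {set 'I_n}) : i < j -> movable i j A ->
    (#|A| == a) && (b <= #|A :&: initial n m|) ->
    (#|swap i j A| == a) && (b <= #|swap i j A :&: initial n m|).
  move=> ij /andP[_ iA] /andP[szA leA]; rewrite card_swap szA /=.
  apply: leq_trans leA (leq_card_swapI iA _).
  by rewrite !inE; apply: ltn_trans.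
have FP : {in F, forall A : {set 'I_n},
    (#|A| == k + t) && (t + s + 1 <= #|A :&: initial n m|)}.
  by move=> A /(subsetP hF); rewrite inE.
have GQ : {in G, forall B : {set 'I_n},
    (#|B| == k) && (s + 1 <= #|B :&: initial n m|)}.
  by move=> B /(subsetP hG); rewrite inE.
have [F' [G' [[<- <-] [F'P G'Q] FF FG [sF sG]]]] :=
  exists_shifted (class _ _) (class _ _) FP GQ hFt hFG.
have le := leq_card_shifted hn hm F'P G'Q FF FG sF sG.
suff : #|F'| + #|G'| + \sum_(0 <= i < s.+1)
    'C(m, i) * binz (n%:Z - m%:Z)%R (k - i) <= 'C(n, k) by lia.
case: (leqP m n) => [mn | nm].
  have -> : (n%:Z - m%:Z)%R = Posz (n - m) by lia.
  have sk : s < k by lia.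
  by apply: leq_trans (card_meet_geq sk mn); apply: leq_add le (leqnn _).
(* For [m > n] the upper index is negative, so the subtracted sum vanishes and counting all k-sets
   suffices. *)
have -> : (n%:Z - m%:Z)%R = Negz (m - n).-1 by lia.
rewrite big1 => [|i _]; last by rewrite muln0.
rewrite addn0; apply: leq_trans le _.
rewrite -[in leqRHS](card_ord n) -card_draws.
by apply/subset_leq_card/subsetP=> B; rewrite !inE => /andP[].
Qed.
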